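(* For integers $n\ge4$, \[ C_{n,3}^{\rm loc}>0\iff n\in\{4,5,7,8,10,13,16,19\}. \] Moreover, \[ C_{n,3}^{\rm loc}=0\iff n\in\{6,9,12,15,18,21,24,27,30\}. \] For all remaining $n\ge4$, $C_{n,3}^{\rm loc}<0$. Thus, among $n\ge4$, the equal point is a strict local minimum of $S_{n,3}$ modulo scaling exactly for $n\in\{4,5,7,8,10,13,16,19\}$, is quadratically degenerate exactly for $n\in\{6,9,12,15,18,21,24,27,30\}$, and is a saddle for all other $n\ge4$.
   Context: Indices are modulo $n$. For $x_i>0$, $S_{n,3}(x)=\sum_{i=1}^n\frac{x_i}{x_{i+1}+x_{i+2}+x_{i+3}}$, homogeneous of degree $0$. The equal point is $(1,\dots,1)$ (considered up to common scaling), where $S_{n,3}=n/3$. Define \[ C_{n,3}^{\rm loc}=\min_{1\le m\le n-1}\frac{|\lambda_{m}|^2-3\operatorname{Re}\lambda_{m}}{27},\qquad \lambda_{m}=\sum_{j=1}^3 e^{2\pi\mathrm{i} mj/n}. \] ''Strict local minimum modulo scaling'' means: there is a neighbourhood $U$ of $(1,\dots,1)$ in the positive orthant such that $S_{n,3}(x)>n/3$ for every nonconstant $x\in U$. ''Quadratically degenerate'' means $C_{n,3}^{\rm loc}=0$, so that there are no $c>0$ and neighbourhood of $(1,\dots,1)$ on which $S_{n,3}(x)-\frac n3\ge c\sum_{i=1}^n(\log x_i-\overline{\log x})^2$, where $\overline{\log x}=\frac1n\sum_{i=1}^n\log x_i$. ''Saddle'' means: the equal point is a critical point of $S_{n,3}$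 and every neighbourhood of it contains positive vectors with $S_{n,3}<n/3$ and positive vectors with $S_{n,3}>n/3$. *)

(* Defs.v *)
From mathcomp Require Import all_boot all_order all_algebra.
From mathcomp Require Import complex.
From mathcomp Require Import all_classical all_reals all_analysis.

Set Implicit Arguments.
Unset Strict Implicit.
Unset Printing Implicit Defensive.

Import Order.TTheory GRing.Theory Num.Theory.
Import numFieldNormedType.Exports.

Local Open Scope classical_set_scope.
Local Open Scope ring_scope.

Section ShapiroType.
Variable R : realType.

Section Sum.
Variable n : nat.

(* [ordS] is the successor modulo [n] on ['I_n], so [iter j (@ordS n) i] is the
   cyclic index [i + j]. The codomain is [R^o] in order to differentiate. *)
Definition S3 (x : 'rV[R]_n) : R^o :=
  \sum_(i < n) x ord0 i / \sum_(1 <= j < 4) x ord0 (iter j (@ordS n) i).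

Definition equal_point : 'rV[R]_n := const_mx 1.

Definition pos_orthant : set 'rV[R]_n := [set x | forall i, 0 < x ord0 i].

Definition constant_vec (x : 'rV[R]_n) : Prop :=
  forall i j, x ord0 i = x ord0 j.

Definition strict_local_min_mod_scaling : Prop :=
  exists U : set 'rV[R]_n,
    [/\ nbhs equal_point U, U `<=` pos_orthant &
        forall x, U x -> ~ constant_vec x -> n%:R / 3 < S3 x].

Definition critical_point (f : 'rV[R]_n -> R^o) (a : 'rV[R]_n) : Prop :=
  differentiable f a /\ 'd f a = cst 0 :> ('rV[R]_n -> R^o).

Definition saddle : Prop :=
  critical_point S3 equal_point /\
  forall U : set 'rV[R]_n, nbhs equal_point U ->
    (exists x, [/\ U x, pos_orthant x & S3 x < n%:R / 3]) /\
    (exists x, [/\ U x, pos_orthant x & n%:R / 3 < S3 x]).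

Definition mean_log (x : 'rV[R]_n) : R := n%:R^-1 * \sum_(i < n) ln (x ord0 i).

Definition quadratic_growth : Prop :=
  exists (c : R) (U : set 'rV[R]_n),
    [/\ 0 < c, nbhs equal_point U, U `<=` pos_orthant &
        forall x, U x ->
          c * \sum_(i < n) (ln (x ord0 i) - mean_log x) ^+ 2
            <= S3 x - n%:R / 3].

End Sum.

Local Open Scope complex_scope.

(* e^(i t) *)
Definition expi (t : R) : R[i] := cos t +i* sin t.

Definition lambda3 (n m : nat) : R[i] :=
  \sum_(1 <= j < 4) expi (2 * pi * (m * j)%:R / n%:R).

Definition Cloc_term (n m : nat) : R :=
  (Normc.normc (lambda3 n m) ^+ 2 - 3 * complex.Re (lambda3 n m)) / 27.

(* The index of a [\big[min/_]] is a default value: here it is the term of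
   index 1, which belongs to the range as soon as [2 <= n]. *)
Definition Cloc (n : nat) : R :=
  \big[Order.min/Cloc_term n 1]_(1 <= m < n) Cloc_term n m.

Definition quadratically_degenerate (n : nat) : Prop := Cloc n = 0.

End ShapiroType.

(* Main.v *)
(* With [c = cos (2 pi m / n)] the [m]-th term of [Cloc] factors as
   [2 / 27 (1 - c) (1 + 2 c) (2 + 3 c)], so it is negative exactly when [c] lies
   in ]-2/3, -1/2[ and its only admissible zero is [c = -1/2], at a third of a
   turn. The rational multiples of a turn that decide whether some [m / n] falls
   in the negative arc are 11/30 (just beyond the arc) and 4/11 (just inside).

   Writing [x = 1 + v], [S3 x - n / 3] is a quadratic form in [v] plus a remainder
   [O(max |v| * sum v^2)]; the discrete Fourier transform diagonalizes the
   quadratic form with eigenvalues the terms of [Cloc]. Positivity on the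
   hyperplane [sum v = 0] gives the strict minimum after normalizing the mean of
   [x]; a negative term gives a descent direction. If [3 %| n], [S3] is constant
   on 3-periodic vectors, which rules out strictness and quadratic growth. *)
Require Import Defs.
From mathcomp Require Import all_boot all_order all_algebra.
From mathcomp Require Import all_classical all_reals all_analysis.
From mathcomp Require Import complex ring lra zify.

Set Implicit Arguments.
Unset Strict Implicit.
Unset Printing Implicit Defensive.

Import Order.TTheory GRing.Theory Num.Theory.
Import numFieldNormedType.Exports.
Local Open Scope ring_scope.

(** * Angles [2 pi m / n] and the factored form of the terms of [Cloc] *)

Section Angles.
Context {R : realType}.
Implicit Types (t : R) (n m : nat).

Definition ang n m : R := 2 * pi * m%:R / n%:R.

Lemma angD n m k : ang n (m + k) = ang n m + ang n k.
Proof. by rewrite /ang natrD mulrDr mulrDl. Qed.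

Lemma angM n m k : ang n (m * k) = ang n k *+ m.
Proof.
elim: m => [|m IH]; first by rewrite mul0n /ang mulr0 mul0r.
by rewrite mulSn angD IH mulrS.
Qed.

Lemma ang_full n m : (0 < n)%N -> ang n (m * n) = (pi *+ 2) *+ m.
Proof.
move=> n0; rewrite /ang natrM mulrA mulfK ?pnatr_eq0 -?lt0n //.
by rewrite mulr_natr mulr_natl.
Qed.

Lemma cos2x t : cos (t + t) = 2 * cos t ^+ 2 - 1.
Proof. by rewrite cosD -!expr2 sin2cos2; ring. Qed.

Lemma cos3x t : cos (t + t + t) = 4 * cos t ^+ 3 - 3 * cos t.
Proof.
rewrite cosD cos2x sinD.
have -> : (sin t * cos t + cos t * sin t) * sin t = 2 * cos t * sin t ^+ 2 by ring.
by rewrite sin2cos2; ring.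
Qed.

Lemma cos_ang_mod n m k :
  (0 < n)%N -> cos (ang n (m * (k %% n))) = cos (ang n (m * k)).
Proof.
move=> n0; rewrite [in RHS](divn_eq k n) mulnDr mulnA angD ang_full // addrC.
by rewrite (periodicn (@cosD2pi R)).
Qed.

Lemma sin_ang_mod n m k :
  (0 < n)%N -> sin (ang n (m * (k %% n))) = sin (ang n (m * k)).
Proof.
move=> n0; rewrite [in RHS](divn_eq k n) mulnDr mulnA angD ang_full // addrC.
by rewrite (periodicn (@sinD2pi R)).
Qed.

Lemma Cloc_termE n m : let c := cos (ang n m) in
  Cloc_term R n m = 2 / 27 * (1 - c) * (1 + 2 * c) * (2 + 3 * c).
Proof.
rewrite /= /Cloc_term /lambda3 3?big_ltn // big_geq //= !addr0.
rewrite -!/(ang _ _) muln1 !mulnS muln0 addn0 addnA !angD.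
rewrite sqr_sqrtr ?addr_ge0 ?sqr_ge0 // !cos3x !cos2x !(sinD, cosD).
move: (sin2cos2 (ang n m)); move: (cos _) (sin _) => c s hs.
(* The imaginary part of [lambda3] is [s] times an even polynomial in [s], so its square involves
   [s] only through [s ^+ 2], which [hs] eliminates. *)
have -> : (s + (s * c + c * s +
   ((s * c + c * s) * c + (c * c - s * s) * s))) ^+ 2 =
   s ^+ 2 * (1 + 2 * c + 3 * c ^+ 2 - s ^+ 2) ^+ 2 by ring.
by rewrite hs; field.
Qed.

Lemma cos_ang_sym n m : (m <= n)%N -> (0 < n)%N ->
  cos (ang n (n - m)) = cos (ang n m).
Proof.
move=> mn n0; have -> : ang n (n - m) = - ang n m + pi *+ 2.
  have := ang_full 1 n0; rewrite mul1n mulr1n => <-.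
  have -> : ang n n = ang n (n - m) + ang n m by rewrite -angD subnK.
  by ring.
by rewrite cosD2pi cosN.
Qed.

End Angles.

(** * Cosine bounds at the angles that delimit the negative arc *)

Section TrigonometricBounds.
Context {R : realType}.
Implicit Types t : R.

Lemma cos_decr t u : 0 <= t -> t < u -> u <= pi -> cos u < cos t.
Proof.
by move=> t0 tu upi; rewrite ltr_cos // in_itv /=; apply/andP; split; lra.
Qed.

Lemma cos_pi3 : cos (pi / 3) = 1 / 2 :> R.
Proof.
have p0 := @pi_gt0 R.
have c0 : 0 < cos (pi / 3) :> R by apply: cos_gt0_pihalf; lra.
have /eqP := cos3x (pi / 3 : R).
have -> : pi / 3 + pi / 3 + pi / 3 = pi :> R by lra.
rewrite cospi -subr_eq0 => /eqP h; set c := cos _ in c0 h *.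
(* This is the factorization of [4 c^3 - 3 c + 1]; positivity of [c] discards the root [-1]. *)
have : (c + 1) * (2 * c - 1) ^+ 2 = 0 by rewrite -[RHS]oppr0 -h; ring.
by move/eqP; rewrite mulf_eq0 expf_eq0 /= => /orP[] /eqP; lra.
Qed.

Lemma cos_2pi3 : cos (2 * pi / 3) = - (1 / 2) :> R.
Proof.
have -> : 2 * pi / 3 = pi / 3 + pi / 3 :> R by lra.
by rewrite cos2x cos_pi3; field.
Qed.

(* [11 pi / 15] is [2 pi / 5 + pi / 3], and [cos (2 pi / 5)] is the positive
   root of [4 c^2 + 2 c - 1]. *)
Lemma cos_11pi15 : cos (11 * pi / 15) < - (2 / 3) :> R.
Proof.
have p0 := @pi_gt0 R.
have -> : 11 * pi / 15 = 2 * pi / 5 + pi / 3 :> R by lra.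
rewrite cosD cos_pi3.
have c0 : 0 < cos (2 * pi / 5) :> R by apply: cos_gt0_pihalf; lra.
have c1 : cos (2 * pi / 5) < 1 :> R by rewrite -[ltRHS]cos0; apply: cos_decr; lra.
have s0 : 0 < sin (2 * pi / 5) :> R by apply: sin_gt0_pi; lra.
have r0 : 0 < sin (pi / 3) :> R by apply: sin_gt0_pi; lra.
have := sin2cos2 (2 * pi / 5 : R); have := sin2cos2 (pi / 3 : R).
(* Three and two fifths of a turn have equal cosines, so [4 c^3 - 3 c = 2 c^2 - 1]; removing the
   root [c = 1] leaves the quadratic. *)
have : cos (2 * pi / 5 + 2 * pi / 5 + 2 * pi / 5) =
       cos (2 * pi / 5 + 2 * pi / 5) :> R.
  have -> : 2 * pi / 5 + 2 * pi / 5 + 2 * pi / 5 =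
            - (2 * pi / 5 + 2 * pi / 5) + pi *+ 2 :> R by lra.
  by rewrite cosD2pi cosN.
rewrite cos3x cos2x cos_pi3.
set c := cos _ in c0 c1 *; set s := sin _ in s0 *; set r := sin _ in r0 *.
move=> h hr hs.
have {h}hc : 4 * c ^+ 2 + 2 * c - 1 = 0.
  have /eqP : (c - 1) * (4 * c ^+ 2 + 2 * c - 1) = 0 by lra.
  by rewrite mulf_eq0 => /orP[] /eqP //; lra.
have : (c / 2 + 2 / 3) ^+ 2 < (s * r) ^+ 2.
  have -> : (s * r) ^+ 2 = s ^+ 2 * r ^+ 2 by ring.
  rewrite hs hr; nra.
rewrite ltr_pXn2r ?nnegrE //; [lra|lra|exact: ltW (mulr_gt0 _ _)].
Qed.

(* Otherwise [cos (pi / 11)] would be so large that [cos (6 pi / 11) > 0]. *)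
Lemma cos_8pi11 : - (2 / 3) < cos (8 * pi / 11) :> R.
Proof.
have p0 := @pi_gt0 R.
rewrite ltNge; apply/negP => hc.
have hc' : -1 <= cos (8 * pi / 11) :> R := cos_geN1 _.
have h2 := cos2x (8 * pi / 11 : R).
have h4 := cos2x (8 * pi / 11 + 8 * pi / 11 : R).
have h2' : cos (8 * pi / 11 + 8 * pi / 11) < 0 :> R.
  have -> : 8 * pi / 11 + 8 * pi / 11 = pi + (pi / 2 - pi / 22) :> R by lra.
  rewrite addrC cosDpi oppr_lt0; apply: cos_gt0_pihalf; lra.
(* Doubling twice: a cosine in [[-1, -2/3]] goes to one in [[-1/9, 0[], then to at most [2/81 - 1],
   while [32 pi / 11] is [3 pi - pi / 11]. *)
have hz : 79 / 81 <= cos (pi / 11) :> R.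
  have : cos (8 * pi / 11 + 8 * pi / 11 + (8 * pi / 11 + 8 * pi / 11)) =
     - cos (pi / 11) :> R.
    have -> : 8 * pi / 11 + 8 * pi / 11 + (8 * pi / 11 + 8 * pi / 11) =
       - (pi / 11) + pi + pi *+ 2 :> R by lra.
    by rewrite cosD2pi cosDpi cosN.
  have h2'' : - (1 / 9) <= cos (8 * pi / 11 + 8 * pi / 11) :> R by nra.
  nra.
have z1 := cos_le1 (pi / 11 : R).
have h3 := cos3x (pi / 11 : R).
have h6 := cos2x (pi / 11 + pi / 11 + pi / 11 : R).
have : cos (pi / 11 + pi / 11 + pi / 11 + (pi / 11 + pi / 11 + pi / 11)) < 0 :> R.
  rewrite -[ltRHS]cos_pihalf; apply: cos_decr; lra.
set z := cos (pi / 11) in hz z1 h3 *.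
have : 3 / 4 <= 4 * z ^+ 3 - 3 * z.
  have -> : 4 * z ^+ 3 - 3 * z = z * (4 * z ^+ 2 - 3) by ring.
  have : (79 / 81) ^+ 2 <= z ^+ 2 by nra.
  nra.
nra.
Qed.

End TrigonometricBounds.

(** * Sign of [Cloc] for each [n] *)

Section Classification.
Context {R : realType}.

Definition stable_n : seq nat := [:: 4; 5; 7; 8; 10; 13; 16; 19]%N.
Definition degenerate_n : seq nat := [:: 6; 9; 12; 15; 18; 21; 24; 27; 30]%N.

(** The minimum is one of the terms; [2 <= n] puts the default index 1 in the range. *)
Lemma Cloc_ind (P : R -> Prop) n : (2 <= n)%N ->
  (forall m, (1 <= m < n)%N -> P (Cloc_term R n m)) -> P (Cloc R n).
Proof.
move=> n2 hP; rewrite /Cloc big_nat; apply: big_ind.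
- by apply: hP; rewrite n2.
- by move=> x y Px Py; rewrite minEle; case: ifP.
- by [].
Qed.

Lemma Cloc_le n m : (1 <= m < n)%N -> Cloc R n <= Cloc_term R n m.
Proof. by move=> mn; apply: ge_bigmin_seq => //; rewrite mem_index_iota. Qed.

Lemma ang_lt_pi n m : (0 < n)%N -> (2 * m <= n)%N -> ang n m <= pi :> R.
Proof.
move=> n0 mn; rewrite /ang ler_pdivrMr ?ltr0n //.
have : (2 * m)%:R <= n%:R :> R by rewrite ler_nat.
rewrite natrM; have := @pi_gt0 R; nra.
Qed.

Lemma cos_ang_lt_1 n m : (1 <= m < n)%N -> cos (ang n m) < 1 :> R.
Proof.
have half k : (0 < n)%N -> (0 < k)%N -> (2 * k <= n)%N -> cos (ang n k) < 1 :> R.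
  move=> n0 k0 kn; rewrite -[ltRHS]cos0; apply: cos_decr; rewrite ?ang_lt_pi //.
  by rewrite divr_gt0 ?mulr_gt0 ?pi_gt0 ?ltr0n.
move=> /andP[m0 mn].
have [h|h] := leqP (2 * m) n; first by apply: half => //; lia.
by rewrite -cos_ang_sym; [apply: half; lia|lia|lia].
Qed.

(* For these [n], no [m / n] lies strictly between [1/3] and [11/30]; the case
   [m / n > 1/2] reduces to [m / n <= 1/2] by symmetry. *)
Lemma Cloc_term_sign n m : (1 <= m < n)%N ->
  n \in stable_n ++ degenerate_n ->
  0 <= Cloc_term R n m ?= iff (cos (ang n m) == - (1 / 2) :> R).
Proof.
move=> mn nL; have n0 : (0 < n)%N by lia.
have p0 := @pi_gt0 R; have c1 := cos_ang_lt_1 mn.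
have half k : (2 * k <= n)%N ->
    - (1 / 2) <= cos (ang n k) :> R \/ cos (ang n k) < - (2 / 3) :> R.
  move=> kn; have [k3|k3] := leqP (3 * k) n.
    left; rewrite -cos_2pi3 le_eqVlt.
    have : (3 * k)%:R <= n%:R :> R by rewrite ler_nat.
    rewrite natrM => k3R.
    have : ang n k <= 2 * pi / 3 :> R.
      by rewrite /ang ler_pdivrMr ?ltr0n //; nra.
    rewrite le_eqVlt => /orP[/eqP->|lt]; first by rewrite eqxx.
    rewrite cos_decr ?orbT //; last lra.
    by rewrite /ang divr_ge0 ?mulr_ge0 ?ler0n //; lra.
  (* Checked on each listed value; equality at [n = 30], [k = 11] is the origin of 11/30. *)
  right; have k30 : (11 * n <= 30 * k)%N.
    by move: nL k3 kn; rewrite !inE; lia.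
  have : (11 * n)%:R <= (30 * k)%:R :> R by rewrite ler_nat.
  rewrite !natrM => k30R; have nR : 0 < n%:R :> R by rewrite ltr0n.
  have : 11 * pi / 15 <= ang n k :> R.
    by rewrite /ang ler_pdivlMr //; nra.
  rewrite le_eqVlt => /orP[/eqP<-|lt]; first exact: cos_11pi15.
  apply: lt_trans cos_11pi15; apply: cos_decr => //; first lra.
  exact: ang_lt_pi.
have : - (1 / 2) <= cos (ang n m) :> R \/ cos (ang n m) < - (2 / 3) :> R.
  have [h|h] := leqP (2 * m) n; first exact: half.
  by rewrite -cos_ang_sym; [apply: half; lia|lia|lia].
rewrite Cloc_termE; set c := cos _ in c1 *.
move=> H; rewrite -!mulrA.
have [-> | cN] := eqVneq c (- (1 / 2)).
  by apply/leifP; lra.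
apply/leifP; do 3 (apply: mulr_gt0; first lra).
(* Below [-2/3] the factors [1 + 2 * c] and [2 + 3 * c] are both negative; above [-1/2] both are
   positive. *)
case: H => H; last nra.
apply: mulr_gt0; last lra.
have : - (1 / 2) < c by rewrite lt_neqAle eq_sym cN.
lra.
Qed.

(** Cosine is injective on [[0, pi]], so up to reflection the angle is a third of a turn and
    [3 * m = n]. *)
Lemma dvdn3_cos_ang n m : (1 <= m < n)%N ->
  cos (ang n m) = - (1 / 2) :> R -> (3 %| n)%N.
Proof.
have half k : (0 < n)%N -> (2 * k <= n)%N -> cos (ang n k) = - (1 / 2) :> R ->
    (3 %| n)%N.
  move=> n0 kn; rewrite -cos_2pi3; have p0 := @pi_gt0 R.
  have kin : ang n k \in `[0, (pi : R)].
    by rewrite in_itv /= ang_lt_pi // divr_ge0 ?mulr_ge0 ?ler0n // ltW.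
  have tin : 2 * pi / 3 \in `[0, (pi : R)].
    by rewrite in_itv /=; apply/andP; split; lra.
  move=> /(cos_inj kin tin) /(congr1 (fun x => 3 * x * n%:R / (2 * pi))) e.
  have : (3 * k)%:R = n%:R :> R.
    have nN : n%:R != 0 :> R by rewrite pnatr_eq0; lia.
    move: e; rewrite /ang natrM; move: (pi : R) (lt0r_neq0 p0) => p pN.
    rewrite (_ : 3 * (2 * p * k%:R / n%:R) * n%:R / (2 * p) = 3 * k%:R).
      by move=> ->; field.
    by field; rewrite pN nN.
  by move=> /eqP; rewrite eqr_nat => /eqP <-; rewrite dvdn_mulr.
move=> /andP[m0 mn] c.
have [h|h] := leqP (2 * m) n; first by apply: (half m) => //; lia.
by apply: (half (n - m)%N); [lia|lia|rewrite cos_ang_sym //; lia].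
Qed.

Lemma Cloc_gt0 n : n \in stable_n -> 0 < Cloc R n.
Proof.
move=> nL; apply: (Cloc_ind (P := fun x => 0 < x)) => [|m mn].
  by move: nL; rewrite !inE; lia.
rewrite (lt_leif (Cloc_term_sign mn _)) ?mem_cat ?nL //.
apply/negP => /eqP /(dvdn3_cos_ang mn).
by move: nL; rewrite !inE; lia.
Qed.

Lemma Cloc_eq0 n : n \in degenerate_n -> Cloc R n = 0.
Proof.
move=> nL; have n3 : (3 * (n %/ 3) = n)%N by move: nL; rewrite !inE; lia.
have [n1 n2] : (0 < n /\ 2 <= n)%N by move: nL; rewrite !inE; lia.
apply/le_anti/andP; split; last first.
  apply: (Cloc_ind (P := fun x => 0 <= x)) => // m mn.
  by apply: (Cloc_term_sign mn _).1; rewrite mem_cat nL orbT.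
apply: le_trans (Cloc_le (m := n %/ 3) _) _; first by lia.
rewrite Cloc_termE; have -> : ang n (n %/ 3) = 2 * pi / 3 :> R.
  have q0 : (n %/ 3)%:R != 0 :> R by rewrite pnatr_eq0; lia.
  have := natrM R 3 (n %/ 3); rewrite n3 /ang => ->.
  by move: (pi : R) => p; field.
by rewrite cos_2pi3; lra.
Qed.

Lemma Cloc_term_lt0 n : (4 <= n)%N -> n \notin stable_n -> n \notin degenerate_n ->
  Cloc_term R n (n %/ 3).+1 < 0.
Proof.
move=> n4 nS nD; have p0 := @pi_gt0 R; set m := _.+1.
(* With [n = 3 q + r], the second inequality reads [q >= 11 - 4 r]; for [n >= 4] it fails exactly on
   the two lists, and equality occurs at 11, 22 and 33. *)
have [m3 m11] : (n < 3 * m /\ 11 * m <= 4 * n)%N.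
  by move: nS nD; rewrite /m !inE; lia.
have nR : 0 < n%:R :> R by rewrite ltr0n; lia.
have lo : - (2 / 3) < cos (ang n m) :> R.
  have : (11 * m)%:R <= (4 * n)%:R :> R by rewrite ler_nat.
  rewrite !natrM => h; apply: lt_le_trans cos_8pi11 _.
  have : ang n m <= 8 * pi / 11 :> R by rewrite /ang ler_pdivrMr //; nra.
  rewrite le_eqVlt => /orP[/eqP->//|lt]; apply: ltW; apply: cos_decr => //.
    by rewrite /ang divr_ge0 ?mulr_ge0 ?ler0n // ltW.
  lra.
have hi : cos (ang n m) < - (1 / 2) :> R.
  rewrite -cos_2pi3; apply: cos_decr; first lra.
    have : n%:R < (3 * m)%:R :> R by rewrite ltr_nat.
    by rewrite natrM /ang ltr_pdivlMr // => h; nra.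
  by apply: ang_lt_pi; lia.
rewrite Cloc_termE; set c := cos _ in lo hi *.
have : 0 < (1 - c) * - (1 + 2 * c) * (2 + 3 * c).
  by rewrite !mulr_gt0 //; lra.
lra.
Qed.

End Classification.

(** * Second-order expansion of [S3] at the equal point *)

Section QuadraticExpansion.
Context {R : realType} {n : nat}.
Implicit Types (v : 'I_n -> R) (x : 'rV[R]_n) (i : 'I_n) (k : nat).

Definition shift_by k i : 'I_n := iter k (@ordS n) i.
Arguments shift_by : simpl never.

Definition window v i : R :=
  v (shift_by 1 i) + v (shift_by 2 i) + v (shift_by 3 i).

Definition autocorr v k : R := \sum_i v i * v (shift_by k i).

(* Half the second derivative of [S3] at the equal point; see [S3_expansion]. *)
Definition hessian v : R :=
  \sum_i (window v i ^+ 2 - 3 * v i * window v i) / 27.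

Lemma shift_byD k l i : shift_by k (shift_by l i) = shift_by (k + l) i.
Proof. by rewrite /shift_by iterD. Qed.

Lemma val_shift_by k i : shift_by k i = ((i + k) %% n)%N :> nat.
Proof.
elim: k => [|k IH]; first by rewrite addn0 modn_small.
rewrite /shift_by iterS -/(shift_by k i).
transitivity ((shift_by k i).+1 %% n)%N => //.
by rewrite IH -addn1 modnDml addn1 addnS.
Qed.

Lemma sum_shift_by (f : 'I_n -> R) k : \sum_i f (shift_by k i) = \sum_i f i.
Proof.
elim: k => [//|k IH]; rewrite -{}IH.
rewrite [RHS](reindex (@ordS n)); last exact/onW_bij/ordS_bij.
by apply: eq_bigr => i _; rewrite -[ordS i]/(shift_by 1 i) shift_byD addn1.
Qed.

Lemma sum_shift_byM v k l :
  \sum_i v (shift_by k i) * v (shift_by (k + l) i) = autocorr v l.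
Proof.
rewrite -[RHS](sum_shift_by (fun i => v i * v (shift_by l i)) k).
by apply: eq_bigr => i _; rewrite shift_byD addnC.
Qed.

(** A product of two shifted entries, summed over the cycle, depends only on the lag. The squared
    window gives weights 3, 4, 2 to lags 0, 1, 2, and the cross term removes 3 from lags 1, 2, 3. *)
Lemma hessianE v : hessian v =
  (3 * autocorr v 0 + autocorr v 1 - autocorr v 2 - 3 * autocorr v 3) / 27.
Proof.
rewrite /hessian -mulr_suml; congr (_ / _).
pose s k l := \sum_i v (shift_by k i) * v (shift_by l i).
have e k l : s k (k + l)%N = autocorr v l := sum_shift_byM v k l.
transitivity (s 1 1 + s 2 2 + s 3 3 + 2 * s 1 2 + 2 * s 2 3 + 2 * s 1 3 -
  3 * (s 0 1 + s 0 2 + s 0 3)); last first.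
  rewrite (e 1 0) (e 2 0) (e 3 0) (e 1 1) (e 2 1) (e 1 2) (e 0 1) (e 0 2) (e 0 3).
  ring.
rewrite !(mulr_sumr, =^~ big_split) -sumrB.
by apply: eq_bigr => i _; rewrite /window /=; ring.
Qed.

Lemma sum_window v : \sum_i window v i = 3 * \sum_i v i.
Proof. by rewrite /window !big_split /= !sum_shift_by; ring. Qed.

Lemma S3E x : S3 x = \sum_i x ord0 i / window (x ord0) i :> R.
Proof.
apply: eq_bigr => i _; congr (_ / _).
by rewrite 3?big_ltn // big_geq // addr0 addrA.
Qed.

Lemma S3_scale x (a : R) : a != 0 -> S3 (a *: x) = S3 x.
Proof.
move=> a0; rewrite !S3E; apply: eq_bigr => i _.
by rewrite /window !mxE -!mulrDr -mulf_div divff // mul1r.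
Qed.

Lemma S3_expansion x v : (forall i, x ord0 i = 1 + v i) ->
  (forall i, 3 + window v i != 0) ->
  (S3 x : R) - n%:R / 3 = hessian v +
    \sum_i (3 * v i - window v i) * window v i ^+ 2 / (27 * (3 + window v i)).
Proof.
move=> xv v0; rewrite S3E /hessian -big_split /=.
have -> : n%:R / 3 = \sum_(i < n) (3^-1 : R).
  by rewrite sumr_const card_ord mulr_natl.
(* The first-order terms cancel because each entry lies in three windows. *)
have z : \sum_i (v i / 3 - window v i / 9) = 0.
  by rewrite sumrB -!mulr_suml sum_window; field.
rewrite -sumrB -[RHS]add0r -[X in _ = X + _]z -big_split /=; apply: eq_bigr => i _.
have -> : window (x ord0) i = 3 + window v i by rewrite /window !xv; ring.
rewrite xv; have := v0 i; move: (window v i) => w w0; field.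
by rewrite w0.
Qed.

Lemma window_bound v i : window v i ^+ 2 <=
  3 * (v (shift_by 1 i) ^+ 2 + v (shift_by 2 i) ^+ 2 + v (shift_by 3 i) ^+ 2).
Proof.
rewrite /window; move: (v _) (v _) (v _) => a b c.
have := sqr_ge0 (a - b); have := sqr_ge0 (b - c); have := sqr_ge0 (a - c).
nra.
Qed.

Lemma sum_window_bound v :
  \sum_i window v i ^+ 2 <= 9 * \sum_i v i ^+ 2.
Proof.
apply: le_trans (ler_sum _ (fun i _ => window_bound v i)) _.
rewrite -mulr_sumr !big_split /= !(sum_shift_by (fun i => v i ^+ 2)).
lra.
Qed.

Lemma hessian_bound v : `|hessian v| <= \sum_i v i ^+ 2.
Proof.
apply: le_trans (ler_norm_sum _ _ _) _.
(* From [3 |v w| <= 3/2 (v^2 + w^2)]; with [sum_window_bound] the total factor is [24/27]. *)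
apply: (@le_trans _ _ (\sum_i (3 / 2 * v i ^+ 2 + 5 / 2 * window v i ^+ 2) / 27)).
  apply: ler_sum => i _; move: (v i) (window v i) => a w.
  have := sqr_ge0 (a - w); have := sqr_ge0 (a + w); have := sqr_ge0 w.
  have := sqr_ge0 a.
  rewrite ler_norml => h1 h2 h3 h4; apply/andP; split; nra.
rewrite -mulr_suml big_split /= -!mulr_sumr.
have s0 : 0 <= \sum_i v i ^+ 2 by apply: sumr_ge0 => i _; exact: sqr_ge0.
have := sum_window_bound v; lra.
Qed.

Lemma S3_taylor x v (d : R) : (forall i, x ord0 i = 1 + v i) ->
  d <= 1 / 2 -> (forall i, `|v i| <= d) ->
  `|(S3 x : R) - n%:R / 3 - hessian v| <= 2 * d * \sum_i v i ^+ 2.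
Proof.
move=> xv d2 vd.
have vN i : - d <= v i <= d by rewrite -ler_norml.
have wN i : - (3 * d) <= window v i <= 3 * d.
  rewrite /window; move: (vN (shift_by 1 i)) (vN (shift_by 2 i)).
  move: (vN (shift_by 3 i)) => /andP[? ?] /andP[? ?] /andP[? ?].
  by apply/andP; split; lra.
have w0 i : 3 / 2 <= 3 + window v i by move: (wN i) => /andP[? ?]; lra.
rewrite (S3_expansion xv); last first.
  by move=> i; apply: lt0r_neq0; apply: lt_le_trans (w0 i); lra.
rewrite addrC addKr; apply: le_trans (ler_norm_sum _ _ _) _.
(* The constant is [6 d / (27 * 3/2)]: the numerator factor is at most [6 d] and the denominator
   uses [3 + window v i >= 3/2]. *)
apply: (@le_trans _ _ (\sum_i (4 / 27 * d) * window v i ^+ 2)).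
  apply: ler_sum => i _; have W := w0 i; have W0 : 0 < 3 + window v i by lra.
  rewrite normrM normfV [`|27 * _|]gtr0_norm; last by rewrite mulr_gt0.
  rewrite ler_pdivrMr ?mulr_gt0 // normrM [`|_ ^+ 2|]ger0_norm ?sqr_ge0 //.
  have h : `|3 * v i - window v i| <= 6 * d.
    rewrite ler_norml; move: (vN i) (wN i) => /andP[? ?] /andP[? ?].
    by apply/andP; split; lra.
  rewrite mulrAC; apply: ler_wpM2r; first exact: sqr_ge0.
  have : 0 <= d by move: (vN i) => /andP[? ?]; lra.
  nra.
rewrite -mulr_sumr; have := sum_window_bound v.
have s0 : 0 <= \sum_i v i ^+ 2 by apply: sumr_ge0 => i _; exact: sqr_ge0.
(* The sign of [d] is read off an index; for [n = 0] both sums are empty. *)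
case: (pickP (@predT 'I_n)) => [i _|no]; last first.
  by rewrite !big_pred0 ?mulr0.
have : 0 <= d by move: (vN i) => /andP[? ?]; lra.
move: (\sum_i _) (\sum_i _) s0 => a b s0 d0 ba; nra.
Qed.

End QuadraticExpansion.

(** * Diagonalization of the quadratic form by the real discrete Fourier transform *)

Section Fourier.
Context {R : realType} {n : nat}.
Implicit Types (u v : 'I_n -> R) (i j : 'I_n) (m k : nat).

(* Telescoping after multiplication by [2 sin (t / 2)]. *)
Lemma dirichlet_kernel (t : R) k :
  2 * sin (t / 2) * \sum_(m < k) cos (t *+ m) =
  sin (t *+ k - t / 2) + sin (t / 2).
Proof.
elim: k => [|k IH].
  by rewrite big_ord0 mulr0 mulr0n sub0r sinN addNr.
rewrite big_ord_recr mulrDr IH /=.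
have -> : t *+ k.+1 - t / 2 = t *+ k + t / 2 by rewrite mulrSr; field.
rewrite sinB sinD; ring.
Qed.

(** Orthogonality of characters: for [i != j], [n] times the angle difference [t] is a whole number
    of turns, so the right side of [dirichlet_kernel] vanishes while [sin (t / 2)] does not. *)
Lemma sum_cos_ang i j :
  \sum_(m < n) cos (ang n (m * i) - ang n (m * j)) =
  if i == j then n%:R else 0 :> R.
Proof.
have [<-|ij] := eqVneq i j.
  rewrite -[RHS]mulr1 -[n in RHS]card_ord mulr_natl -sumr_const.
  by apply: eq_bigr => m _; rewrite subrr cos0.
have n0 : (0 < n)%N := leq_ltn_trans (leq0n i) (ltn_ord i).
have nR : 0 < n%:R :> R by rewrite ltr0n.
have p0 := @pi_gt0 R.
pose t : R := ang n i - ang n j.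
have mt m : ang n (m * i) - ang n (m * j) = t *+ m.
  by rewrite /t mulrnBl -!angM.
have := dirichlet_kernel t n; rewrite -mt ![(n * _)%N]mulnC !ang_full //.
have -> : (pi *+ 2) *+ i - (pi *+ 2) *+ j - t / 2 =
    - (pi *+ 2) *+ j - t / 2 + (pi *+ 2) *+ i :> R by rewrite mulNrn; ring.
rewrite (periodicn (@sinD2pi R)).
have -> : - (pi *+ 2) *+ j - t / 2 = - (t / 2 + (pi *+ 2) *+ j) :> R.
  by rewrite mulNrn; ring.
rewrite sinN (periodicn (@sinD2pi R)) addNr => /eqP.
rewrite !mulf_eq0 pnatr_eq0 /= => /orP[|/eqP h]; last first.
  by rewrite -[RHS]h; apply: eq_bigr => m _; rewrite mt.
have ltn1 (k : 'I_n) : k%:R < n%:R :> R by rewrite ltr_nat.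
have tE : t / 2 = pi * ((i%:R - j%:R) / n%:R).
  by rewrite /t /ang; field; rewrite lt0r_neq0.
have iR := ltn1 i; have jR := ltn1 j.
have i0 := ler0n R i; have j0 := ler0n R j.
have x1 : -1 < (i%:R - j%:R) / n%:R :> R.
  by rewrite ltr_pdivlMr // mulN1r; lra.
have x2 : (i%:R - j%:R) / n%:R < 1 :> R.
  by rewrite ltr_pdivrMr // mul1r; lra.
have x0 : (i%:R - j%:R) / n%:R != 0 :> R.
  by apply: mulf_neq0; rewrite ?invr_eq0 ?subr_eq0 ?eqr_nat // lt0r_neq0.
rewrite tE; move: (_ / _) x0 x1 x2 => x x0 x1 x2.
case: (ltgtP x 0) x0 => // x0 _.
  rewrite -[x]opprK mulrN sinN oppr_eq0 gt_eqF //.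
  by apply: sin_gt0_pi; apply/andP; split; nra.
by rewrite gt_eqF //; apply: sin_gt0_pi; apply/andP; split; nra.
Qed.

Definition fourier_cos v m : R := \sum_i v i * cos (ang n (m * i)).
Definition fourier_sin v m : R := \sum_i v i * sin (ang n (m * i)).
Definition power v m : R := fourier_cos v m ^+ 2 + fourier_sin v m ^+ 2.

Lemma parseval u v :
  \sum_(m < n) (fourier_cos u m * fourier_cos v m +
                fourier_sin u m * fourier_sin v m) =
  n%:R * \sum_i u i * v i.
Proof.
transitivity (\sum_(m < n) \sum_i \sum_j
    u i * v j * cos (ang n (m * i) - ang n (m * j))).
  apply: eq_bigr => m _; rewrite /fourier_cos /fourier_sin !big_distrlr -big_split.
  apply: eq_bigr => i _; rewrite -big_split; apply: eq_bigr => j _ /=.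
  by rewrite cosB; ring.
rewrite exchange_big mulr_sumr; apply: eq_bigr => i _.
rewrite exchange_big (bigD1 i) //= [X in _ + X]big1 => [|j ji].
  by rewrite -mulr_sumr sum_cos_ang eqxx addr0 mulrC.
by rewrite -mulr_sumr sum_cos_ang eq_sym (negbTE ji) mulr0.
Qed.

Lemma cos_ang_shift m k i : cos (ang n (m * shift_by k i)) =
  cos (ang n (m * i) + ang n (m * k)) :> R.
Proof.
have n0 : (0 < n)%N := leq_ltn_trans (leq0n i) (ltn_ord i).
by rewrite val_shift_by cos_ang_mod // mulnDr angD.
Qed.

Lemma sin_ang_shift m k i : sin (ang n (m * shift_by k i)) =
  sin (ang n (m * i) + ang n (m * k)) :> R.
Proof.
have n0 : (0 < n)%N := leq_ltn_trans (leq0n i) (ltn_ord i).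
by rewrite val_shift_by sin_ang_mod // mulnDr angD.
Qed.

(** A cyclic shift rotates the pair of coefficients of frequency [m] by the angle
    [ang n (m * k)]. *)
Lemma fourier_cos_shift v m k : let w := fun i => v (shift_by k i) in
  fourier_cos v m = cos (ang n (m * k)) * fourier_cos w m -
                    sin (ang n (m * k)) * fourier_sin w m.
Proof.
rewrite /= [LHS]/fourier_cos.
rewrite -(sum_shift_by (fun i => v i * cos (ang n (m * i))) k).
rewrite /fourier_cos /fourier_sin !mulr_sumr -sumrB; apply: eq_bigr => i _.
by rewrite cos_ang_shift cosD; ring.
Qed.

Lemma fourier_sin_shift v m k : let w := fun i => v (shift_by k i) in
  fourier_sin v m = sin (ang n (m * k)) * fourier_cos w m +
                    cos (ang n (m * k)) * fourier_sin w m.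
Proof.
rewrite /= [LHS]/fourier_sin.
rewrite -(sum_shift_by (fun i => v i * sin (ang n (m * i))) k).
rewrite /fourier_cos /fourier_sin !mulr_sumr -big_split; apply: eq_bigr => i _.
by rewrite sin_ang_shift sinD /=; ring.
Qed.

(** Finite Wiener-Khinchin formula: [parseval] applied to [v] and its shift, whose coefficients
    differ by a rotation. *)
Lemma autocorr_fourier v k : n%:R * autocorr v k =
  \sum_(m < n) cos (ang n (m * k)) * power v m.
Proof.
rewrite -parseval; apply: eq_bigr => m _; rewrite /power.
rewrite !(fourier_cos_shift v m k) !(fourier_sin_shift v m k).
move: (fourier_cos _ _) (fourier_sin _ _) => a b.
move: (cos2Dsin2 (ang n (m * k) : R)); move: (cos _) (sin _) => c s cs.
transitivity (c * (a ^+ 2 + b ^+ 2)); first by ring.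
by rewrite -[LHS]mulr1 -cs; ring.
Qed.

(** Same coefficients as in [hessianE], with cosines for autocorrelations; this makes the term an
    eigenvalue. *)
Lemma Cloc_term_cos m : Cloc_term R n m =
  (3 * cos (ang n (m * 0)) + cos (ang n (m * 1)) - cos (ang n (m * 2)) -
   3 * cos (ang n (m * 3))) / 27.
Proof.
rewrite Cloc_termE muln0 /ang mulr0 mul0r -!/(ang _ _) cos0.
by rewrite !mulnS muln0 addn0 addnA !angD cos2x cos3x; field.
Qed.

Lemma hessian_fourier v :
  n%:R * hessian v = \sum_(m < n) Cloc_term R n m * power v m.
Proof.
rewrite hessianE mulrA !(mulrDr, mulrN) ![n%:R * (3 * _)]mulrCA !autocorr_fourier.
rewrite !mulr_sumr -!sumrN -!big_split mulr_suml; apply: eq_bigr => m _ /=.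
by rewrite Cloc_term_cos; ring.
Qed.

Lemma hessian_ge v : (2 <= n)%N -> \sum_i v i = 0 ->
  Cloc R n * \sum_i v i ^+ 2 <= hessian v.
Proof.
move=> n2 v0; have nR : 0 < n%:R :> R by rewrite ltr0n; lia.
rewrite -(ler_pM2l nR) hessian_fourier mulrCA.
have -> : n%:R * \sum_i v i ^+ 2 = \sum_(m < n) power v m.
  by rewrite -parseval; apply: eq_bigr => m _; rewrite /power -!expr2.
rewrite mulr_sumr; apply: ler_sum => m _.
have P0 : 0 <= power v m by rewrite addr_ge0 ?sqr_ge0.
have [m0|m0] := posnP m; last first.
  by apply: ler_wpM2r => //; apply: Cloc_le; rewrite m0 ltn_ord.
(* Frequency 0 is outside the range of [Cloc]; its power is the squared sum of [v], which is
   zero. *)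
suff -> : power v m = 0 by rewrite !mulr0.
rewrite /power /fourier_cos /fourier_sin m0.
have a0 i : ang n (0 * i) = 0 :> R by rewrite mul0n /ang mulr0 mul0r.
under eq_bigr do rewrite a0 cos0 mulr1.
under [X in _ + X ^+ 2]eq_bigr do rewrite a0 sin0 mulr0.
by rewrite v0 big1 // expr0n addr0.
Qed.

(* On the two real eigenvectors of frequency [m], the autocorrelations add up to
   [n cos (ang n (m * k))]. *)
Lemma hessian_cos_sin m :
  hessian (fun i : 'I_n => cos (ang n (m * i)) : R) +
  hessian (fun i : 'I_n => sin (ang n (m * i))) = n%:R * Cloc_term R n m.
Proof.
pose u i : R := cos (ang n (m * i)); pose v i : R := sin (ang n (m * i)).
have e k : autocorr u k + autocorr v k = n%:R * cos (ang n (m * k)).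
  rewrite -big_split mulr_natl -[n in RHS]card_ord -sumr_const /=.
  apply: eq_bigr => i _; rewrite /u /v cos_ang_shift sin_ang_shift -cosB.
  by rewrite opprD addrA subrr add0r cosN card_ord.
rewrite !hessianE -mulrDl Cloc_term_cos.
have -> (a b c d a' b' c' d' : R) : 3 * a + b - c - 3 * d +
  (3 * a' + b' - c' - 3 * d') =
  3 * (a + a') + (b + b') - (c + c') - 3 * (d + d') by ring.
by rewrite !e; ring.
Qed.

(** The cosine and sine vectors have a negative total, so one of them has a negative value. *)
Lemma hessian_lt0 m : (0 < n)%N -> Cloc_term R n m < 0 ->
  exists v, (forall i, `|v i| <= 1) /\ hessian v < 0.
Proof.
move=> n0 Tm; have := hessian_cos_sin m.
have : n%:R * Cloc_term R n m < 0 by rewrite pmulr_rlt0 ?ltr0n.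
have [h _ _|h] := ltP (hessian (fun i : 'I_n => cos (ang n (m * i)) : R)) 0.
  exists (fun i => cos (ang n (m * i))); split => // i; exact: cos_max.
move=> T e; exists (fun i => sin (ang n (m * i))); split; last lra.
move=> i; exact: sin_max.
Qed.

End Fourier.

(** The hypothesis is a little-o estimate with zero linear part; uniqueness of the differential
    concludes. *)
Lemma null_differential (R : realType) (V W : normedModType R) (f : V -> W) (a : V) :
  (forall eps : R, 0 < eps ->
     \forall h \near (0 : V), `|f (h + a) - f a| <= eps * `|h|) ->
  differentiable f a /\ 'd f a = cst 0 :> (V -> W).
Proof.
move=> fo.
have fE : f \o shift a = cst (f a) + \0 +o_ (0 : V) id.
  apply/eqaddoP => eps /fo; apply: filterS => h.
  by rewrite -[(_ - _) h]/(f (h + a) - (f a + 0)) addr0.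
have d0 : 'd f a = cst 0 :> (V -> W).
  by apply: diff_unique fE; exact: cst_continuous.
split=> //; apply/diff_locallyP; rewrite d0; split => //.
exact: cst_continuous.
Qed.

(** * Strict minima, saddles and flat directions at the equal point *)

Section LocalBehaviour.
Context {R : realType} {n : nat}.
Implicit Types (v : 'I_n -> R) (x : 'rV[R]_n) (U : set 'rV[R]_n).

Lemma nbhs_equal_point U : nbhs (equal_point R n) U <->
  exists2 e : R, 0 < e &
    forall x, (forall i, `|x ord0 i - 1| < e) -> U x.
Proof.
split=> [/nbhs_ballP[e e0 eU]|[e e0 eU]].
  exists e => // x xe; apply: eU; split => // i j.
  by rewrite (ord1 i) /ball /= mxE distrC; exact: xe.
apply/nbhs_ballP; exists e => // x [_ xe]; apply: eU => i.
by have := xe ord0 i; rewrite /ball /= mxE distrC.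
Qed.

Lemma S3_constant x : (forall i, 0 < x ord0 i) -> constant_vec x ->
  S3 x = n%:R / 3 :> R.
Proof.
move=> x0 xc; rewrite S3E mulr_natl -[n in RHS]card_ord -sumr_const.
apply: eq_bigr => i _; rewrite /window (xc (shift_by 1 i) i).
rewrite (xc (shift_by 2 i) i) (xc (shift_by 3 i) i); have := x0 i.
by move: (x ord0 i) => a a0; field; rewrite lt0r_neq0 //; lra.
Qed.

Lemma strict_local_min_of_Cloc_gt0 : (2 <= n)%N -> 0 < Cloc R n ->
  strict_local_min_mod_scaling R n.
Proof.
move=> n2; set C := Cloc R n => C0.
have n0 : 0 < n%:R :> R by rewrite ltr0n; lia.
(* With [d <= C / 4] the error [2 * d] in [S3_taylor] is at most half of the coercivity constant.
   The radius [d / 4] leaves room for dividing by the mean. *)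
pose d := Num.min (1 / 2) (C / 4).
have d0 : 0 < d by rewrite lt_min; apply/andP; split; lra.
have d1 : d <= 1 / 2 by rewrite ge_min lexx.
have dC : d <= C / 4 by rewrite ge_min lexx orbT.
exists [set x : 'rV[R]_n | forall i, `|x ord0 i - 1| < d / 4]%classic; split.
- by apply/nbhs_equal_point; exists (d / 4) => //; lra.
- by move=> x /= xd i; have := xd i; rewrite ltr_norml => /andP[? ?]; lra.
move=> x /= xd xN.
have xb i : 1 - d / 4 <= x ord0 i <= 1 + d / 4.
  by have := xd i; rewrite ltr_norml => /andP[? ?]; apply/andP; split; lra.
pose mu := (\sum_i x ord0 i) / n%:R.
have cst_sum (a : R) : \sum_(i < n) a = a * n%:R.
  by rewrite sumr_const card_ord mulr_natr.
have mu1 : 1 - d / 4 <= mu.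
  rewrite ler_pdivlMr // -cst_sum; apply: ler_sum => i _.
  by case/andP: (xb i).
have mu2 : mu <= 1 + d / 4.
  rewrite ler_pdivrMr // -cst_sum; apply: ler_sum => i _.
  by case/andP: (xb i).
have mu0 : 0 < mu by lra.
(* Scaling to mean 1 preserves [S3] and puts [v] on the hyperplane where [hessian_ge] applies. *)
pose v i := mu^-1 * x ord0 i - 1.
have sv : \sum_i v i = 0.
  rewrite sumrB cst_sum mul1r -mulr_sumr.
  have -> : \sum_i x ord0 i = mu * n%:R by rewrite divfK // lt0r_neq0.
  by rewrite mulrA mulVf ?mul1r ?subrr // lt0r_neq0.
have vx i : (mu^-1 *: x) ord0 i = 1 + v i by rewrite mxE /v; ring.
have vd i : `|v i| <= d.
  have -> : v i = (x ord0 i - mu) / mu.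
    by rewrite /v mulrBl divff ?lt0r_neq0 // mulrC.
  rewrite normrM normfV (gtr0_norm mu0) ler_pdivrMr // ler_norml.
  by move: (xb i) => /andP[? ?]; apply/andP; split; nra.
have := S3_taylor vx d1 vd; rewrite S3_scale ?invr_neq0 ?lt0r_neq0 //.
have := hessian_ge n2 sv; rewrite -/C.
have s0 : 0 < \sum_i v i ^+ 2.
  rewrite lt_def sumr_ge0 ?andbT => [|i _]; last exact: sqr_ge0.
  apply/negP => /eqP /psumr_eq0P sq0; apply: xN => i j.
  have vz k : x ord0 k = mu.
    have /eqP := sq0 (fun i _ => sqr_ge0 _) k isT.
    rewrite expf_eq0 /= subr_eq0 => /eqP /(congr1 ( *%R mu)).
    by rewrite mulrA divff ?lt0r_neq0 // mul1r mulr1.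
  by rewrite !vz.
rewrite ler_norml => h /andP[h' _]; rewrite -subr_gt0.
have : 2 * d * \sum_i v i ^+ 2 <= C / 2 * \sum_i v i ^+ 2.
  by rewrite ler_pM2r //; lra.
have : 0 < C * \sum_i v i ^+ 2 by rewrite mulr_gt0.
lra.
Qed.

(** Along [1 + t v] the quadratic term [t^2 q] dominates the cubic error [2 t^3 s] for small [t].
    Stating it by the sign of a product serves both sides of the saddle. *)
Lemma hessian_sign v U : (forall i, `|v i| <= 1) -> hessian v != 0 ->
  nbhs (equal_point R n) U -> exists x,
    [/\ U x, pos_orthant x & 0 < ((S3 x : R) - n%:R / 3) * hessian v].
Proof.
move=> v1 q0 /nbhs_equal_point[e e0 eU]; set q := hessian v in q0 *.
set s := \sum_i v i ^+ 2.
have s0 : 0 <= s by apply: sumr_ge0 => i _; exact: sqr_ge0.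
have aq0 : 0 < `|q| by rewrite normr_gt0.
pose t := Num.min (Num.min (1 / 2) (e / 2)) (`|q| / (4 * (s + 1))).
have t0 : 0 < t.
  rewrite !lt_min; apply/andP; split; last by rewrite divr_gt0 // mulr_gt0; lra.
  by apply/andP; split; lra.
have t1 : t <= 1 / 2 by rewrite !ge_min lexx.
have te : t <= e / 2 by rewrite !ge_min lexx orbT.
have tq : 2 * t * s < `|q|.
  have : t <= `|q| / (4 * (s + 1)) by rewrite ge_min lexx orbT.
  rewrite ler_pdivlMr; last by rewrite mulr_gt0; lra.
  nra.
pose w i := t * v i.
pose x := \row_i (1 + w i) : 'rV[R]_n.
have xw i : x ord0 i = 1 + w i by rewrite mxE.
have wt i : `|w i| <= t.
  by rewrite normrM (gtr0_norm t0) -[leRHS]mulr1 ler_pM2l.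
have hw : hessian w = t ^+ 2 * q.
  by rewrite /q /hessian mulr_sumr; apply: eq_bigr => i _; rewrite /window /w; ring.
have sw : \sum_i w i ^+ 2 = t ^+ 2 * s.
  by rewrite mulr_sumr; apply: eq_bigr => i _; rewrite exprMn.
exists x; split.
- apply: eU => i; rewrite xw addrC addKr; apply: le_lt_trans (wt i) _; lra.
- move=> i; rewrite xw; have := wt i; rewrite ler_norml => /andP[? ?]; lra.
have := S3_taylor xw t1 wt; rewrite hw sw.
move: ((S3 x : R) - _) => D; rewrite ler_norml => /andP[lo hi].
have t2 : 0 < t ^+ 2 by rewrite exprn_gt0.
have k : 2 * t * (t ^+ 2 * s) < t ^+ 2 * `|q|.
  by rewrite mulrCA ltr_pM2l.
have [q1|q1] := ltP 0 q.
  by rewrite gtr0_norm // in k; apply: mulr_gt0 => //; lra.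
by rewrite ler0_norm // in k; rewrite nmulr_rgt0 ?lt_neqAle ?q0 //; lra.
Qed.

Lemma critical_equal_point : critical_point (@S3 R n) (equal_point R n).
Proof.
apply: null_differential => eps eps0.
(* The increment is at most [2 * s], hence at most [2 n |h|^2], with [s] the sum of squares of [h];
   [n + 1] keeps the divisor positive for every [n]. *)
pose d := Num.min (1 / 2) (eps / (2 * (n%:R + 1))).
have n0 := ler0n R n.
have d0 : 0 < d.
  rewrite lt_min; apply/andP; split; first lra.
  by rewrite divr_gt0 // mulr_gt0; lra.
have d1 : d <= 1 / 2 by rewrite ge_min lexx.
have d2 : 2 * d * n%:R <= eps.
  have : d <= eps / (2 * (n%:R + 1)) by rewrite ge_min lexx orbT.
  rewrite ler_pdivlMr; last by rewrite mulr_gt0; lra.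
  nra.
have S1 : S3 (equal_point R n) = n%:R / 3 :> R.
  by apply: S3_constant => [i|i j]; rewrite !mxE.
apply/nbhs_norm0P; exists d => // h /= hd.
have hi i : `|h ord0 i| <= `|h|.
  rewrite -[leRHS]/(mx_norm h) mx_normrE.
  exact: (le_bigmax _ (fun ij => `|h ij.1 ij.2|) (ord0, i)).
have hE i : (h + equal_point R n) ord0 i = 1 + h ord0 i.
  by rewrite !mxE addrC.
have h12 : `|h| <= 1 / 2 by apply: ltW; apply: lt_le_trans hd d1.
have := S3_taylor hE h12 hi; have := hessian_bound (h ord0).
rewrite S1 -[X in _ -> _ -> X]/(is_true
  (`|(S3 (h + equal_point R n) : R) - n%:R / 3| <= eps * `|h|)).
have : \sum_i h ord0 i ^+ 2 <= n%:R * `|h| ^+ 2.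
  have <- : \sum_(i < n) `|h| ^+ 2 = n%:R * `|h| ^+ 2.
    by rewrite sumr_const card_ord mulr_natl.
  apply: ler_sum => i _.
  by rewrite -real_normK ?num_real // ler_pXn2r ?nnegrE.
have s0 : 0 <= \sum_i h ord0 i ^+ 2 by apply: sumr_ge0 => i _; exact: sqr_ge0.
move: (\sum_i _) ((S3 _ : R) - _) (hessian _) (`|h|) (normr_ge0 h) hd h12 s0.
move=> s D q a a0 ad a12 s0 sa; rewrite !ler_norml => /andP[? ?] /andP[? ?].
have na : n%:R * a <= n%:R * d by apply: ler_wpM2l => //; exact: ltW.
have : 2 * n%:R * a * a <= eps * a by apply: ler_wpM2r => //; lra.
have : 2 * s <= 2 * n%:R * a * a by lra.
have : 2 * a * s <= s by nra.
by move=> ? ? ?; apply/andP; split; lra.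
Qed.

Lemma saddle_of_term_lt0 m : (4 <= n)%N -> Cloc_term R n m < 0 -> saddle R n.
Proof.
move=> n4 Tm; have n0 : (0 < n)%N by lia.
split; first exact: critical_equal_point.
move=> U nU; split.
  have [v [v1 hv]] := hessian_lt0 n0 Tm.
  have [x [Ux px]] := hessian_sign v1 (ltr0_neq0 hv) nU.
  by rewrite nmulr_lgt0 // subr_lt0 => ?; exists x.
(* An ascent direction is the bump at one index: as [n >= 4], its autocorrelations at lags 1, 2, 3
   vanish and the form equals [1/9]. *)
pose i0 : 'I_n := Ordinal n0.
pose v (i : 'I_n) : R := (i == i0)%:R.
have v1 i : `|v i| <= 1 by rewrite /v normr_nat lern1 leq_b1.
have a0 : autocorr v 0 = 1.
  rewrite /autocorr (bigD1 i0) //= big1 ?addr0 => [|i /negbTE ii0].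
    by rewrite /v /shift_by eqxx mulr1.
  by rewrite /v ii0 mul0r.
have ak k : (0 < k < n)%N -> autocorr v k = 0.
  move=> kn; apply: big1 => i _; rewrite /v; case: eqVneq => [->|_].
    by rewrite -val_eqE /= val_shift_by /= add0n modn_small ?gtn_eqF ?mulr0 //; lia.
  by rewrite mul0r.
have hv : 0 < hessian v by rewrite hessianE a0 !ak; [lra|lia|lia|lia].
have [x [Ux px]] := hessian_sign v1 (lt0r_neq0 hv) nU.
by rewrite pmulr_lgt0 // subr_gt0 => ?; exists x.
Qed.

(* If [3 %| n], the window sums of a 3-periodic vector are all equal, so [S3] is
   constant on 3-periodic vectors. *)
Lemma periodic_flat U : (0 < n)%N -> (3 %| n)%N ->
  nbhs (equal_point R n) U -> exists x,
    [/\ U x, pos_orthant x, ~ constant_vec x & S3 x = n%:R / 3 :> R].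
Proof.
move=> n0 n3 /nbhs_equal_point[e e0 eU].
pose b k : R := if (3 %| k)%N then e / 2 else 0.
pose x := \row_(i < n) (1 + b i) : 'rV[R]_n.
have b0 k : 0 <= b k by rewrite /b; case: ifP => _; lra.
have bw i : window (x ord0) i = 3 + e / 2.
  (* Divisibility by 3 survives reduction modulo [n], so each window meets exactly one raised
     entry. *)
  have dm k : (3 %| k %% n)%N = (3 %| k)%N.
    by rewrite [in RHS](divn_eq k n) dvdn_addr // dvdn_mull.
  rewrite /window !mxE /b !val_shift_by !dm.
  by do 3 case: ifP => ?; solve [lra | exfalso; lia].
exists x; split.
- apply: eU => i; rewrite mxE addrC addKr ger0_norm // /b.
  by case: ifP => _; lra.
- by move=> i; rewrite mxE; have := b0 i; lra.
- have n1 : (1 < n)%N by move: n0 n3; lia.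
  move=> /(_ (Ordinal n0) (Ordinal n1)); rewrite !mxE /b /=; lra.
rewrite S3E; under eq_bigr do rewrite bw.
have h := sum_window (x ord0).
rewrite (eq_bigr _ (fun i _ => bw i)) sumr_const card_ord -[_ *+ n]mulr_natl in h.
rewrite -mulr_suml.
have -> : \sum_i x ord0 i = n%:R * (3 + e / 2) / 3 by rewrite h; field.
by field; rewrite lt0r_neq0 //; lra.
Qed.

Lemma not_strict_local_min : (0 < n)%N -> (3 %| n)%N ->
  ~ strict_local_min_mod_scaling R n.
Proof.
move=> n0 n3 [U [nU _ Umin]]; have [x [Ux _ xN Sx]] := periodic_flat n0 n3 nU.
have : n%:R / 3 < (S3 x : R) := Umin x Ux xN.
by rewrite Sx ltxx.
Qed.

(** At a flat nonconstant point the growth bound would force all logarithms to be equal. *)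
Lemma not_quadratic_growth : (0 < n)%N -> (3 %| n)%N -> ~ quadratic_growth R n.
Proof.
move=> n0 n3 [c [U [c0 nU _ Ugrow]]].
have [x [Ux px xN Sx]] := periodic_flat n0 n3 nU.
have : c * \sum_i (ln (x ord0 i) - mean_log x) ^+ 2 <= (S3 x : R) - n%:R / 3.
  exact: Ugrow.
rewrite Sx subrr pmulr_rle0 // => s0; apply: xN.
have sq0 : \sum_i (ln (x ord0 i) - mean_log x) ^+ 2 = 0.
  by apply/le_anti; rewrite s0 sumr_ge0 // => i _; exact: sqr_ge0.
have lnx i : ln (x ord0 i) = mean_log x.
  have /(_ i isT)/eqP := psumr_eq0P (fun i _ => sqr_ge0 _) sq0.
  by rewrite expf_eq0 /= subr_eq0 => /eqP.
by move=> i j; apply: ln_inj; rewrite ?posrE ?lnx //; exact: px.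
Qed.

(** A point of smaller value cannot be constant, since constant vectors give exactly [n / 3]. *)
Lemma saddle_not_strict_local_min : saddle R n -> ~ strict_local_min_mod_scaling R n.
Proof.
move=> [_ sd] [U [nU Upos Umin]]; have [[x [Ux px Sx]] _] := sd U nU.
have SxR : (S3 x : R) < n%:R / 3 := Sx.
have [xc|xN] := pselect (constant_vec x).
  by move: SxR; rewrite S3_constant ?ltxx.
have : n%:R / 3 < (S3 x : R) := Umin x Ux xN.
by move=> /(lt_trans SxR); rewrite ltxx.
Qed.

End LocalBehaviour.

(** * The trichotomy in [n], for [Cloc] and for the equal point *)

Theorem theorem11p1 (R : realType) (n : nat) (hn : (4 <= n)%N) :
  (0 < Cloc R n <-> n \in [:: 4; 5; 7; 8; 10; 13; 16; 19]%N) /\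
  (Cloc R n = 0 <-> n \in [:: 6; 9; 12; 15; 18; 21; 24; 27; 30]%N) /\
  (n \notin [:: 4; 5; 7; 8; 10; 13; 16; 19]%N ->
   n \notin [:: 6; 9; 12; 15; 18; 21; 24; 27; 30]%N -> Cloc R n < 0) /\
  (strict_local_min_mod_scaling R n <->
   n \in [:: 4; 5; 7; 8; 10; 13; 16; 19]%N) /\
  (quadratically_degenerate R n <->
   n \in [:: 6; 9; 12; 15; 18; 21; 24; 27; 30]%N) /\
  (quadratically_degenerate R n -> ~ quadratic_growth R n) /\
  (n \notin [:: 4; 5; 7; 8; 10; 13; 16; 19]%N ->
   n \notin [:: 6; 9; 12; 15; 18; 21; 24; 27; 30]%N -> saddle R n).
Proof.
have n0 : (0 < n)%N by lia.
have disj : n \in stable_n -> n \in degenerate_n -> False.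
  by rewrite !inE; lia.
have d3 : n \in degenerate_n -> (3 %| n)%N by rewrite !inE; lia.
have neg : n \notin stable_n -> n \notin degenerate_n -> Cloc R n < 0.
  move=> nS nD; apply: le_lt_trans _ (Cloc_term_lt0 hn nS nD).
  by apply: Cloc_le; lia.
have sad : n \notin stable_n -> n \notin degenerate_n -> saddle R n.
  by move=> nS nD; exact: saddle_of_term_lt0 hn (Cloc_term_lt0 hn nS nD).
have zero : Cloc R n = 0 <-> n \in degenerate_n.
  split=> [C0|]; last exact: Cloc_eq0.
  apply/negPn/negP => nD; have [nS|nS] := boolP (n \in stable_n).
    by have := Cloc_gt0 (R := R) nS; rewrite C0 ltxx.
  by have := neg nS nD; rewrite C0 ltxx.
split; last split; last split; last split; last split; last split => //.
- split=> [C0|]; last exact: Cloc_gt0.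
  apply/negPn/negP => nS; have [nD|nD] := boolP (n \in degenerate_n).
    by move: C0; rewrite zero.2 // ltxx.
  by have := lt_trans C0 (neg nS nD); rewrite ltxx.
- exact: zero.
- exact: neg.
- split=> [smin|nS]; last first.
    by apply: strict_local_min_of_Cloc_gt0; [lia|exact: Cloc_gt0].
  apply/negPn/negP => nS; have [nD|nD] := boolP (n \in degenerate_n).
    exact: not_strict_local_min n0 (d3 nD) smin.
  exact: saddle_not_strict_local_min (sad nS nD) smin.
- exact: zero.
- by move=> /zero/d3; exact: not_quadratic_growth.
Qed.
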